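(* Let $h\in\mathbb{N}$ be fixed and let $G_n^h$ be the preferential attachment graph. Then for every $\varepsilon>0$, with high probability as $n\to\infty$, $$\mathrm{mod}(G_n^h)\le \frac{(1+\varepsilon)f(h)}{\sqrt h},$$ where $$f(h)=6g_{\mathcal V}(h)+4\sqrt{2\ln 2}-\frac{g_{\mathcal V}(h)^2}{\sqrt h},\qquad g_{\mathcal V}(h)=\frac16\sqrt{2\ln 2\,(9\ln h+8\ln 2)}+\frac23\ln 2+2.$$
   Context: $\mathbb N=\{1,2,\dots\}$, $[n]=\{1,\dots,n\}$. With high probability (as $n\to\infty$) means with probability tending to $1$ as $n\to\infty$, with $h$ (and $\varepsilon$) fixed. Graphs are finite, undirected, and may have loops and multiple edges. For a graph $G=(V,E)$ let $e(G)=|E|$ (with multiplicity, each loop counted once); $\deg(v)$ is the number of edges containing $v$, with loops counted twice; for $S\subseteq V$, $\mathrm{vol}(S)=\sum_{v\in S}\deg(v)$, $\mathrm{vol}(G)=\mathrm{vol}(V)$, and $e(S)$ is the number of edges (including loops, counted once, and with multiplicity) with all endpoints in $S$. Modularity: for a graph $G$ with at least one edge and a partition $\mathcal A$ of $V$, $\mathrm{mod}_{\mathcal A}(G)=\sum_{S\in\mathcal A}\left(\frac{e(S)}{e(G)}-\left(\frac{\mathrm{vol}(S)}{\mathrm{vol}(G)}\right)^2\right)$, and $\mathrm{mod}(G)=\max_{\mathcal A}\mathrm{mod}_{\mathcal A}(G)$, the maximum being over all partitions of $V$. Preferential attachment graph $G_n^h$: Phase 1. $T_1$ is the graph with the single (mini-)vertex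 $1$ and a single loop at it (so its degree is $2$). For $t\ge1$, given $T_t$, the graph $T_{t+1}$ is obtained by adding the mini-vertex $t+1$ and one edge joining it to a random mini-vertex $i$, where, conditionally on the history, $\Pr(i=s)=\frac{\deg_{T_t}(s)}{2t+1}$ for $1\le s\le t$ and $\Pr(i=t+1)=\frac1{2t+1}$ (a loop). Continue until $T_{hn}$ is obtained. Phase 2. $G_n^h$ is obtained from $T_{hn}$ by merging, for each $i\in[n]$, the mini-vertices $h(i-1)+1,\dots,h(i-1)+h$ into a single vertex $i$, keeping loops and multiple edges. *)

(* Defs.v *)
From HB Require Import structures.
From mathcomp Require Import all_boot all_order all_algebra.
From mathcomp Require Import all_classical all_reals all_analysis.

Set Implicit Arguments.
Unset Strict Implicit.
Unset Printing Implicit Defensive.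

Import Order.TTheory GRing.Theory Num.Theory.
Local Open Scope ring_scope.

(** A multigraph on the vertex set [V] is the list of its edges; an edge is
    given by its two endpoints (equal for a loop).  Neither the orientation of
    the pairs nor the order of the list matters below. *)
Definition multigraph (V : finType) := seq (V * V).

Section Modularity.
Variables (R : realType) (V : finType) (G : multigraph V).
Implicit Types (v : V) (S : {set V}) (A : {set {set V}}).

Definition nb_edges : nat := size G.

Definition deg v : nat :=
  (count (fun e => e.1 == v) G + count (fun e => e.2 == v) G)%N.

Definition vol S : nat := (\sum_(v in S) deg v)%N.

Definition edges_in S : nat := count (fun e => (e.1 \in S) && (e.2 \in S)) G.

Definition modularity_of A : R :=
  \sum_(S in A) ((edges_in S)%:R / nb_edges%:R
                 - ((vol S)%:R / (vol [set: V])%:R) ^+ 2).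

(** The default value of the iterated maximum is the value at the one-block
    partition, which is one of the partitions as soon as [V] is nonempty. *)
Definition modularity : R :=
  \big[Num.max/modularity_of [set [set: V]]]_(A : {set {set V}} | finset.partition A [set: V])
    modularity_of A.

End Modularity.

Section PreferentialAttachment.
Variable R : realType.

(** Mini-vertices are numbered from 0.  A history [w] of length [m] records the
    endpoint [w t] chosen by each mini-vertex [t] on arrival. *)
Definition history (m : nat) := {ffun 'I_m -> 'I_m}.

(** The graph with mini-vertices [0, ..., t - 1] and [t] edges; the later
    mini-vertices are kept in the vertex type. *)
Definition pa_tree m (w : history m) (t : nat) : multigraph 'I_m :=
  [seq (u, w u) | u : 'I_m <- enum 'I_m & (u < t)%N].

(** The conditional probability, given the first [t] choices of [w], that
    mini-vertex [t] attaches to [s].  For [t = 0] it puts mass 1 on the loop, so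
    the process starts from a single loop at mini-vertex [0]. *)
Definition attach_prob m (w : history m) (t s : 'I_m) : R :=
  if (s < t)%N then (deg (pa_tree w t) s)%:R / (2 * t + 1)%N%:R
  else if s == t then 1 / (2 * t + 1)%N%:R
  else 0.

Definition pa_law m (w : history m) : R :=
  \prod_(t < m) attach_prob w t (w t).

Definition pa_prob m (E : pred (history m)) : R :=
  \sum_(w : history m | E w) pa_law w.

Lemma block_subproof h n (k : 'I_(h * n)) : (k %/ h < n)%N.
Proof.
case: h k => [|h] k; first by case: k.
by rewrite ltn_divLR // (leq_trans (ltn_ord k)) // mulnC.
Qed.

Definition block h n (k : 'I_(h * n)) : 'I_n := Ordinal (block_subproof k).

Definition pa_graph h n (w : history (h * n)) : multigraph 'I_n :=
  [seq (block e.1, block e.2) | e <- pa_tree w (h * n)].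

End PreferentialAttachment.

Section Bound.
Variable R : realType.

Definition gV (h : nat) : R :=
  1 / 6 * Num.sqrt (2 * ln 2 * (9 * ln h%:R + 8 * ln 2)) + 2 / 3 * ln 2 + 2.

Definition fbound (h : nat) : R :=
  6 * gV h + 4 * Num.sqrt (2 * ln 2) - gV h ^+ 2 / Num.sqrt h%:R.

End Bound.

(* Main.v *)
(** Colour the vertices with signs [x = -1, 1].  Drawing one independent sign
    per part of a partition shows that its modularity is the average of
    [(1/m) sum_(uv edge) x u x v - (sum_v deg v x v / 2m)^2], so it is enough to
    bound this score by [8 / sqrt h] for the [2^n] colourings ([fbound h >= 8]).

    Let [D t] be the sum of [deg v x v] over the first [t] edges and
    [p t = (D t + x t) / (2t+1)] the conditional mean of [x (w t)].  Then
    [x t x (w t) - (D (t+1)^2 / 4(t+1) - D t^2 / 4t)] is, up to [1/t], the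
    martingale difference [(x t - p t) (x (w t) - p t)].  Summing over [t], the
    score times [m = h n] is at most a martingale with bounded increments plus
    [sum_t 1/t <= h + n], so its exponential moment at [1 / (8 sqrt h)] is at
    most [exp (n/16 + (h + n)/8)].  Exceeding [8 m / sqrt h] gains [exp (- n)],
    which beats this and the factor [2^n] of the union bound. *)

Require Import Defs.
From HB Require Import structures.
From mathcomp Require Import all_boot all_order all_algebra.
From mathcomp Require Import all_classical all_reals all_analysis.
From mathcomp Require Import ring lra.

Set Implicit Arguments.
Unset Strict Implicit.
Unset Printing Implicit Defensive.

Import Order.TTheory GRing.Theory Num.Theory.
Import numFieldNormedType.Exports.
Local Open Scope classical_set_scope.
Local Open Scope ring_scope.

(** * A quadratic bound on the exponential *)

Lemma expR_le_quadratic (R : realType) (x : R) :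
  x <= 1 / 2 -> expR x <= 1 + x + x ^+ 2.
Proof.
move=> hx.
have h1 : 1 - x / 3 <= expR (- (x / 3)) by exact: expR_ge1Dx.
(* The cube makes the lower bound on [expR (- x)] sharp enough: its product with [1 + x + x ^+ 2]
   stays at least 1 for all [x] up to 1/2. *)
have h2 : (1 - x / 3) ^+ 3 <= expR (- x).
  have -> : - x = 3%:R * - (x / 3) by field.
  by rewrite expRM_natl lerXn2r // nnegrE ?expR_ge0 //; lra.
have h3 : 0 <= 1 + x + x ^+ 2 by nra.
have h4 : 1 <= (1 + x + x ^+ 2) * (1 - x / 3) ^+ 3.
  have -> : (1 + x + x ^+ 2) * (1 - x / 3) ^+ 3
    = 1 + x ^+ 2 * ((9 - 19 * x + 8 * x ^+ 2 - x ^+ 3) / 27) by field.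
  rewrite lerDl mulr_ge0 ?sqr_ge0 //.
  suff : 0 <= x ^+ 2 * (1 / 2 - x) by move=> ?; nra.
  by rewrite mulr_ge0 ?sqr_ge0 //; lra.
have h5 := le_trans h4 (ler_wpM2l h3 h2).
by rewrite -(ler_pM2r (expR_gt0 (- x))) -expRD subrr expR0.
Qed.

(** * A constant lower bound on [fbound] *)

Section FBound.
Variable R : realType.

Lemma ln2_ge_half : 1 / 2 <= ln 2 :> R.
Proof.
rewrite -ler_expR lnK ?posrE //.
have := @expR_ge1Dx R (- (1 / 2)); rewrite expRN => h.
have e0 := expR_gt0 (1 / 2 : R).
have : (1 - 1 / 2) * expR (1 / 2) <= 1 :> R.
  by rewrite -ler_pdivlMr // (mul1r (expR _)^-1).
move: (expR _) => e; lra.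
Qed.

(** Since [gV] lies between 2 and [4 * sqrt h], the subtracted term is at most [4 * gV]; what
    remains is at least [2 * gV + 4 * sqrt (2 ln 2)], and both summands are at least 4. *)
Lemma fbound_ge8 (h : nat) : (0 < h)%N -> 8 <= fbound R h.
Proof.
move=> h0; set H : R := h%:R; set s : R := Num.sqrt H.
have H1 : 1 <= H by rewrite ler1n.
have s1 : 1 <= s by rewrite -sqrtr1 ler_wsqrtr.
have sK : s ^+ 2 = H by rewrite sqr_sqrtr // ltW // (lt_le_trans ltr01).
have l2 := ln2_ge_half.
have l1 : ln 2 <= 1 :> R.
  have := @le_ln1Dx R 1; rewrite (_ : 1 + 1 = 2) // => h'.
  by apply: h'; lra.
have lh : ln H <= H - 1.
  have := @le_ln1Dx R (H - 1); rewrite (addrC 1) subrK => -> //; lra.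
have lh0 : 0 <= ln H by rewrite ln_ge0.
have q1 : 1 <= Num.sqrt (2 * ln 2) :> R.
  by rewrite -[leLHS]sqrtr1 ler_wsqrtr //; lra.
have r0 := sqrtr_ge0 (2 * ln 2 * (9 * ln H + 8 * ln 2)).
have r1 : Num.sqrt (2 * ln 2 * (9 * ln H + 8 * ln 2)) <= 6 * s.
  rewrite -[leRHS]ger0_norm; last lra.
  rewrite -sqrtr_sqr ler_wsqrtr // exprMn sK.
  have : ln 2 * (9 * ln H + 8 * ln 2) <= 1 * (9 * ln H + 8 * ln 2) :> R.
    by rewrite ler_wpM2r //; lra.
  by lra.
have g2 : 2 <= gV R h by rewrite /gV -/H; lra.
have g4 : gV R h <= 4 * s by rewrite /gV -/H; lra.
have : gV R h ^+ 2 / s <= 4 * gV R h.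
  rewrite ler_pdivrMr; last lra.
  by rewrite mulrAC expr2 ler_wpM2r //; lra.
by rewrite /fbound -/H -/s; lra.
Qed.

End FBound.

(** * Modularity as an average over random signs of the parts *)

Section SignAverage.
Variables (R : realType) (V : finType) (G : multigraph V).

(** Each vertex occurs as often as its degree, a loop counting twice, so sums over this list are
    degree-weighted. *)
Definition endpoints : seq V := map fst G ++ map snd G.

Definition sign_score (x : V -> R) : R :=
  (\sum_(e <- G) x e.1 * x e.2) / (size G)%:R
  - ((\sum_(v <- endpoints) x v) / (2 * (size G)%:R)) ^+ 2.

Lemma vol_endpoints (S : {set V}) :
  (vol G S)%:R = \sum_(v <- endpoints) (v \in S)%:R :> R.
Proof.
have -> : vol G S = (\sum_(v <- endpoints) (v \in S))%N.
  rewrite /vol big_mkcond /=.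
  rewrite (eq_bigr (fun v => \sum_(u <- endpoints) (u == v) * (v \in S)))%N.
    rewrite exchange_big /=; apply: eq_bigr => u _.
    rewrite (bigD1 u) //= eqxx mul1n big1 ?addn0 // => v /negbTE.
    by rewrite eq_sym => ->.
  move=> v _; rewrite -big_distrl /=.
  have -> : deg G v = (\sum_(u <- endpoints) (u == v))%N.
    transitivity (count (pred1 v) endpoints).
      by rewrite count_cat !count_map.
    by rewrite -sumn_count sumnE big_map.
  by case: (v \in S); rewrite ?muln1 ?muln0.
by rewrite natr_sum.
Qed.

Lemma vol_setT : vol G [set: V] = (2 * size G)%N.
Proof.
apply/eqP; rewrite -(eqr_nat R) vol_endpoints.
rewrite (eq_bigr (fun=> 1%:R)) => [|v _]; last by rewrite inE.
by rewrite -natr_sum sum1_size size_cat !size_map mul2n addnn.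
Qed.

Lemma edges_in_sum (S : {set V}) :
  (edges_in G S)%:R = \sum_(e <- G) ((e.1 \in S) && (e.2 \in S))%:R :> R.
Proof.
rewrite /edges_in -sum1_count big_mkcond natr_sum.
by apply: eq_bigr => e _; case: ifP.
Qed.

Variables (A : {set {set V}}) (partA : finset.partition A [set: V]).

(** Signs are drawn for all subsets of [V], which keeps the sample space a plain function type; only
    the values on parts of [A] matter. *)
Definition block_sign (tau : {ffun {set V} -> bool}) (v : V) : R :=
  (-1) ^+ tau (finset.pblock A v).

(** Signs of distinct parts are independent and centred, so only pairs inside one part
    contribute. *)
Lemma sum_block_sign (u v : V) :
  \sum_tau block_sign tau u * block_sign tau v =
  #|{ffun {set V} -> bool}|%:R * \sum_(S in A) ((u \in S) && (v \in S))%:R.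
Proof.
have [/eqP covA tI _] := and3P partA.
have cov z : z \in finset.cover A by rewrite covA inE.
have sumE : \sum_(S in A) ((u \in S) && (v \in S))%:R
    = (finset.pblock A u == finset.pblock A v)%:R :> R.
  rewrite (bigD1 (finset.pblock A u)) ?finset.pblock_mem //=.
  rewrite finset.mem_pblock cov /=.
  rewrite big1 ?addr0 => [|S /andP[SA neS]].
    by rewrite finset.eq_pblock.
  case: (boolP (u \in S)) => //= uS.
  by rewrite -(finset.def_pblock tI SA uS) eqxx in neS.
rewrite sumE; case: eqP => [e|/eqP ne].
  rewrite mulr1 (eq_bigr (fun=> 1)) => [|tau _].
    by rewrite sumr_const.
  by rewrite /block_sign e -signr_addb addbb.
rewrite mulr0.
(* Flipping the sign of the part of [u] negates every term when [v] lies in another part, so the sum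
   equals its opposite. *)
pose flip (tau : {ffun {set V} -> bool}) : {ffun {set V} -> bool} :=
  [ffun S => tau S (+) (S == finset.pblock A u)].
have flipK : involutive flip.
  by move=> tau; apply/ffunP => S; rewrite !ffunE -addbA addbb addbF.
set s := LHS.
suff : s = - s by move=> ?; lra.
rewrite /s {1}(reindex_inj (inv_inj flipK)) -sumrN; apply: eq_bigr => tau _.
rewrite /block_sign !ffunE eqxx (eq_sym (finset.pblock A v)) (negbTE ne).
rewrite addbF addbT.
by rewrite signrN mulNr.
Qed.

(** By linearity, [sum_block_sign] over the edges yields the numbers [edges_in], and over pairs of
    endpoints, after expanding the square, the squared volumes. *)
Lemma sum_sign_score :
  \sum_tau sign_score (block_sign tau) =
  #|{ffun {set V} -> bool}|%:R * modularity_of R G A.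
Proof.
rewrite /sign_score /modularity_of !sumrB mulrBr; congr (_ - _).
  rewrite -!mulr_suml mulrA; congr (_ / _).
  rewrite exchange_big /= (eq_bigr _ (fun e _ => sum_block_sign e.1 e.2)).
  rewrite -mulr_sumr exchange_big /=; congr (_ * _).
  by apply: eq_bigr => S _; rewrite edges_in_sum.
rewrite vol_setT natrM.
under eq_bigr do rewrite exprMn.
under [in RHS]eq_bigr do rewrite exprMn.
rewrite -!mulr_suml [RHS]mulrA; congr (_ * _).
have sq (F : V -> R) : (\sum_(v <- endpoints) F v) ^+ 2
    = \sum_(u <- endpoints) \sum_(v <- endpoints) F u * F v.
  by rewrite expr2 big_distrlr.
under eq_bigr do rewrite sq.
under [in RHS]eq_bigr do rewrite vol_endpoints sq.
rewrite exchange_big [in RHS]exchange_big mulr_sumr /=; apply: eq_bigr => u _.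
rewrite exchange_big [in RHS]exchange_big mulr_sumr /=; apply: eq_bigr => v _.
rewrite sum_block_sign; congr (_ * _); apply: eq_bigr => S _.
by rewrite -natrM mulnb.
Qed.

Lemma modularity_of_le_sign (c : R) :
  (forall x : {ffun V -> bool}, sign_score (fun v => (-1) ^+ x v) <= c) ->
  modularity_of R G A <= c.
Proof.
move=> le_c.
have N0 : 0 < #|{ffun {set V} -> bool}|%:R :> R.
  by rewrite ltr0n; apply/card_gt0P; exists [ffun=> true].
rewrite -(ler_pM2l N0) -sum_sign_score mulr_natl -sumr_const.
apply: ler_sum => tau _.
have := le_c [ffun v => tau (finset.pblock A v)].
by under eq_fun do rewrite ffunE.
Qed.

End SignAverage.

Lemma modularity_le_sign (R : realType) (V : finType) (G : multigraph V)
    (c : R) (v0 : V) :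
  (forall x : {ffun V -> bool}, sign_score G (fun v => (-1) ^+ x v) <= c) ->
  modularity R G <= c.
Proof.
move=> le_c; apply: bigmax_le => [|A partA].
  (* The default of the maximum is the one-block partition, whose block is nonempty because of
     [v0]. *)
  apply: modularity_of_le_sign le_c; apply/and3P; split.
  - by rewrite /finset.cover big_set1.
  - exact: finset.trivIset1.
  - by rewrite inE; apply/negP => /eqP/setP/(_ v0); rewrite !inE.
exact: modularity_of_le_sign le_c.
Qed.

(** * Sums over histories weighted by kernels that see only the past *)

Section Kernel.
Variables (R : realType) (m : nat).
Implicit Types (w : history m) (t s : 'I_m) (k : nat).

Definition resample w t s : history m :=
  [ffun u => if u == t then s else w u].

(** Exchanging [s] with [w t] is an involution on pairs that turns the resampled history back into
    the first component, so every history is counted [m] times. *)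
Lemma sum_resample (f : history m -> R) t :
  \sum_w f w = m%:R^-1 * \sum_w \sum_s f (resample w t s).
Proof.
have m0 : m%:R != 0 :> R by rewrite pnatr_eq0 -lt0n (leq_ltn_trans _ (ltn_ord t)).
pose swap (a : history m * 'I_m) := (resample a.1 t a.2, a.1 t).
have swapK : involutive swap.
  case=> w s; rewrite /swap /= !ffunE eqxx; congr pair.
  by apply/ffunP => u; rewrite !ffunE; case: eqP => [->|].
rewrite pair_big (reindex_inj (inv_inj swapK)) /=.
rewrite (eq_bigr (fun a : history m * 'I_m => f a.1)).
  rewrite -(pair_big xpredT xpredT (fun w _ => f w)) /=.
  under [in RHS]eq_bigr do rewrite sumr_const card_ord -mulr_natl.
  by rewrite -mulr_sumr mulKf.
move=> [w s] _; congr f; apply/ffunP => u /=; rewrite !ffunE.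
by case: eqP => [->|].
Qed.

Variable K : history m -> 'I_m -> 'I_m -> R.
Hypothesis K_past : forall w w' t s,
  (forall u : 'I_m, (u < t)%N -> w u = w' u) -> K w t s = K w' t s.

Definition path_weight k w : R := \prod_(t < m | (t < k)%N) K w t (w t).

(** The choices from time [k] on do not affect [path_weight k] and are averaged
    out uniformly. *)
Definition path_mass k : R := m%:R^-1 ^+ (m - k) * \sum_w path_weight k w.

Lemma path_mass0 : path_mass 0 = 1.
Proof.
rewrite /path_mass subn0 /path_weight.
under eq_bigr do rewrite big_pred0_eq.
rewrite sumr_const card_ffun card_ord natrX -exprMn.
case: m => [|m']; first by rewrite expr0.
by rewrite mulVf ?expr1n // pnatr_eq0.
Qed.

Lemma path_massT : path_mass m = \sum_w \prod_(t < m) K w t (w t).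
Proof.
rewrite /path_mass subnn expr0 mul1r; apply: eq_bigr => w _.
by apply: eq_bigl => t; rewrite ltn_ord.
Qed.

(** Resampling choice [t] changes neither [path_weight t] nor the kernel at time [t], so that choice
    can be summed out; its factor [1/m] raises the exponent from [m - t.+1] to [m - t]. *)
Lemma path_massS t :
  path_mass t.+1 =
  m%:R^-1 ^+ (m - t) * \sum_w path_weight t w * \sum_s K w t s.
Proof.
rewrite /path_mass (sum_resample _ t) mulrA -exprSr -subSn //.
rewrite subSS; congr (_ * _); apply: eq_bigr => w _.
rewrite mulr_sumr; apply: eq_bigr => s _.
rewrite /path_weight (bigD1 t) //= mulrC; congr (_ * _).
  rewrite (eq_bigl (fun u : 'I_m => (u < t)%N)); last first.
    by move=> u /=; rewrite ltnS ltn_neqAle andbC.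
  apply: eq_bigr => u ut; rewrite !ffunE.
  rewrite -val_eqE (ltn_eqF ut); apply: K_past => v vu.
  by rewrite ffunE -val_eqE (ltn_eqF (ltn_trans vu ut)).
rewrite ffunE eqxx; apply: K_past => u ut.
by rewrite ffunE -val_eqE (ltn_eqF ut).
Qed.

(** Kernel sums are constrained only along paths of nonzero weight: for [attach_prob] the sum is
    computed assuming that no earlier choice points to a later mini-vertex, which nonzero weight
    guarantees. *)
Lemma sum_path_weight_eq1 :
  (forall w t, path_weight t w != 0 -> \sum_s K w t s = 1) ->
  \sum_w \prod_(t < m) K w t (w t) = 1.
Proof.
move=> K1; rewrite -path_massT.
suff : forall k, (k <= m)%N -> path_mass k = 1 by apply.
elim=> [|k IH] km; first exact: path_mass0.
rewrite (path_massS (Ordinal km)) -[RHS](IH (ltnW km)); congr (_ * _).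
apply: eq_bigr => w _.
have [->|w0] := eqVneq (path_weight k w) 0; first by rewrite mul0r.
by rewrite (K1 _ (Ordinal km)) ?mulr1.
Qed.

(** Serves for exponential moments: one-step bounds on a tilted kernel multiply to a bound on its
    total mass. *)
Lemma sum_path_weight_le (C : nat -> R) :
  (forall w t s, 0 <= K w t s) -> (forall k, 0 <= C k) ->
  (forall w t, path_weight t w != 0 -> \sum_s K w t s <= C t) ->
  \sum_w \prod_(t < m) K w t (w t) <= \prod_(t < m) C t.
Proof.
move=> K0 C0 KC; rewrite -path_massT.
suff : forall k, (k <= m)%N -> path_mass k <= \prod_(t < k) C t by apply.
elim=> [|k IH] km; first by rewrite path_mass0 big_ord0.
rewrite (path_massS (Ordinal km)) big_ord_recr /=.
apply: le_trans (ler_wpM2r (C0 k) (IH (ltnW km))).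
rewrite /path_mass -mulrA ler_wpM2l ?exprn_ge0 ?invr_ge0 //.
rewrite mulr_suml; apply: ler_sum => w _.
have [->|w0] := eqVneq (path_weight k w) 0; first by rewrite !mul0r.
by rewrite ler_wpM2l ?prodr_ge0 // (KC _ (Ordinal km)).
Qed.

End Kernel.

(** * The attachment law and its conditional means *)

Section Attachment.
Variables (R : realType) (m : nat).
Implicit Types (w : history m) (t s : 'I_m).

Lemma pa_tree_past w w' t :
  (forall u : 'I_m, (u < t)%N -> w u = w' u) -> pa_tree w t = pa_tree w' t.
Proof.
move=> e; apply/eq_in_map => u; rewrite mem_filter => /andP[ut _].
by rewrite e.
Qed.

Lemma attach_prob_past w w' t s :
  (forall u : 'I_m, (u < t)%N -> w u = w' u) ->
  attach_prob R w t s = attach_prob R w' t s.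
Proof. by move=> e; rewrite /attach_prob (pa_tree_past e). Qed.

Lemma attach_prob_ge0 w t s : 0 <= attach_prob R w t s.
Proof.
by rewrite /attach_prob; do 2?[case: ifP => _]; rewrite ?divr_ge0.
Qed.

Lemma pa_law_ge0 w : 0 <= pa_law R w.
Proof. by rewrite prodr_ge0 // => t _; exact: attach_prob_ge0. Qed.

Lemma attach_prob_loop_or_past w t s : attach_prob R w t s != 0 -> (s <= t)%N.
Proof.
rewrite /attach_prob; case: ltnP => [/ltnW //|ts].
by case: (eqVneq s t) => [->|_] //; rewrite eqxx.
Qed.

Lemma sum_deg (G : multigraph 'I_m) (g : 'I_m -> R) :
  \sum_s (deg G s)%:R * g s = \sum_(e <- G) (g e.1 + g e.2).
Proof.
have countE (s : 'I_m) (p : 'I_m * 'I_m -> 'I_m) :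
    (count (fun e => p e == s) G)%:R = \sum_(e <- G) (p e == s)%:R :> R.
  by rewrite -sumn_count sumnE big_map natr_sum.
have pick (u : 'I_m) : \sum_s (u == s)%:R * g s = g u.
  rewrite (bigD1 u) //= eqxx mul1r big1 ?addr0 // => s /negbTE.
  by rewrite eq_sym => ->; rewrite mul0r.
under eq_bigr do rewrite /deg natrD !countE -big_split mulr_suml /=.
rewrite exchange_big /=; apply: eq_bigr => e _.
under eq_bigr do rewrite mulrDl.
by rewrite big_split /= !pick.
Qed.

Lemma sum_pa_tree w (t : nat) (f : 'I_m * 'I_m -> R) :
  \sum_(e <- pa_tree w t) f e = \sum_(u < m | (u < t)%N) f (u, w u).
Proof. by rewrite big_map big_filter big_enum_cond. Qed.

(** Under the hypothesis, mini-vertices from [t] on have degree 0 in the tree, so all cases of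
    [attach_prob] read [(deg s + [s = t]) / (2t+1)]; the weighted handshake identity [sum_deg] does
    the rest. *)
Lemma attach_mean w t (g : 'I_m -> R) :
  (forall u : 'I_m, (u < t)%N -> (w u <= u)%N) ->
  \sum_s attach_prob R w t s * g s =
  (\sum_(u < m | (u < t)%N) (g u + g (w u)) + g t) / (2 * t + 1)%N%:R.
Proof.
move=> wle.
have deg0 s : (t <= s)%N -> deg (pa_tree w t) s = 0%N.
  move=> ts; rewrite /deg; apply/eqP; rewrite addn_eq0 !eqn0Ngt.
  rewrite -!has_count -!all_predC.
  apply/andP; split; apply/allP => e /mapP[u];
    rewrite mem_filter => /andP[ut _] -> /=; rewrite -val_eqE neq_ltn.
    by rewrite (leq_trans ut ts).
  by rewrite (leq_ltn_trans (wle _ ut) (leq_trans ut ts)).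
have attachE s : attach_prob R w t s * g s =
    ((deg (pa_tree w t) s)%:R * g s + (t == s)%:R * g s) / (2 * t + 1)%N%:R.
  rewrite /attach_prob -mulrDl (eq_sym t s) mulrAC; congr (_ * _).
  case: ltnP => st; first by rewrite -val_eqE (ltn_eqF st) addr0.
  by rewrite deg0 // add0r; case: (s == t); rewrite ?mul0r.
under eq_bigr do rewrite attachE.
rewrite -mulr_suml big_split sum_deg sum_pa_tree /=; congr ((_ + _) / _).
rewrite (bigD1 t) //= eqxx mul1r big1 ?addr0 // => s /negbTE.
by rewrite eq_sym => ->; rewrite mul0r.
Qed.

Lemma path_weight_neq0_le (K : history m -> 'I_m -> 'I_m -> R) w t :
  (forall u : 'I_m, K w u (w u) != 0 -> attach_prob R w u (w u) != 0) ->
  path_weight K t w != 0 -> forall u : 'I_m, (u < t)%N -> (w u <= u)%N.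
Proof.
move=> KA /prodf_neq0 nz u ut.
by apply: attach_prob_loop_or_past; apply: KA; apply: nz.
Qed.

Lemma sum_attach_prob w t :
  (forall u : 'I_m, (u < t)%N -> (w u <= u)%N) ->
  \sum_s attach_prob R w t s = 1.
Proof.
move=> wle; have := attach_mean (fun=> 1) wle.
under eq_bigr do rewrite mulr1.
move=> ->.
rewrite -(big_ord_widen_cond m xpredT (fun=> 1 + 1)) ?(ltnW (ltn_ord t)) //.
rewrite sumr_const card_ord natrD natrM mulr1n mulr_natr.
by rewrite divff // -mulrSr pnatr_eq0.
Qed.

Lemma sum_pa_law : \sum_(w : history m) pa_law R w = 1.
Proof.
apply: (@sum_path_weight_eq1 R m (@attach_prob R m)) => [w w' t s|w t w0].
  exact: attach_prob_past.
exact/sum_attach_prob/(path_weight_neq0_le (fun u => id) w0).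
Qed.

End Attachment.

(** * Elementary inequalities *)

Lemma sum_inv_le (R : realType) (h m : nat) : (0 < h)%N ->
  \sum_(t < m) t%:R^-1 <= h%:R + m%:R / h%:R :> R.
Proof.
move=> h0; have hR : 0 < h%:R :> R by rewrite ltr0n.
have inv_le (t : nat) : t%:R^-1 <= 1 :> R.
  by case: t => [|t]; rewrite ?invr0 ?ler01 // invf_le1 ?ltr0n ?ler1n.
(* Terms with index below [h] cost at most 1 each, the others at most [1/h]; [minn m h] counts the
   former through the induction. *)
suff : \sum_(t < m) t%:R^-1 <= (minn m h)%:R + m%:R / h%:R :> R.
  by move/le_trans; apply; rewrite lerD2r ler_nat geq_minr.
elim: m => [|m IH]; first by rewrite big_ord0 min0n mul0r addr0.
rewrite big_ord_recr /=.
have [mh|hm] := ltnP m h.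
  rewrite (minn_idPl (mh : (m.+1 <= h)%N)).
  rewrite (minn_idPl (ltnW mh)) in IH.
  rewrite -!natr1 mulrDl mul1r.
  have := inv_le m; have : 0 <= h%:R^-1 :> R by rewrite invr_ge0 ltW.
  lra.
rewrite (minn_idPr (leqW hm)); rewrite (minn_idPr hm) in IH.
have : m%:R^-1 <= h%:R^-1 :> R.
  by rewrite lef_pV2 ?posrE ?ltr0n ?ler_nat ?(leq_trans h0 hm).
rewrite -!natr1 mulrDl mul1r; lra.
Qed.

Lemma sqr_sub_le4 (R : realType) (a b : R) :
  -1 <= a <= 1 -> -1 <= b <= 1 -> (a - b) ^+ 2 <= 4.
Proof.
move=> /andP[? ?] /andP[? ?]; rewrite -subr_ge0.
have -> : 4 - (a - b) ^+ 2 = (2 - (a - b)) * (2 + (a - b)) by ring.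
by rewrite mulr_ge0 //; lra.
Qed.

Lemma mul_le4 (R : realType) (a b : R) :
  a ^+ 2 <= 4 -> b ^+ 2 <= 4 -> a * b <= 4.
Proof. by have := sqr_ge0 (a - b); rewrite sqrrB -mulr_natr; lra. Qed.

(** * The signed degree walk and its exponential moment *)

Section SignWalk.
Variables (R : realType) (m : nat) (x : 'I_m -> R).
Hypothesis x_sq : forall t, x t ^+ 2 = 1.
Implicit Types (w : history m) (t : 'I_m) (k : nat).

(** This is [D k], the signed volume of the tree with [k] edges. *)
Definition walk w k : R := \sum_(u < m | (u < k)%N) (x u + x (w u)).

(** The conditional mean of [x (w t)] given the choices before time [t]. *)
Definition drift w t : R := (walk w t + x t) / (2 * t + 1)%N%:R.

Lemma walk0 w : walk w 0 = 0.
Proof. by rewrite /walk big_pred0_eq. Qed.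

Lemma walkS w t : walk w t.+1 = walk w t + (x t + x (w t)).
Proof.
rewrite /walk (bigD1 t) //= addrC; congr (_ + _); apply: eq_bigl => u.
by rewrite ltnS ltn_neqAle andbC.
Qed.

Lemma walkT w : walk w m = \sum_(u < m) (x u + x (w u)).
Proof. by apply: eq_bigl => u; rewrite ltn_ord. Qed.

Lemma sign_bounds t : -1 <= x t <= 1.
Proof.
have : x t ^+ 2 == 1 by rewrite x_sq.
by rewrite sqrf_eq1 => /orP[] /eqP ->; apply/andP; split; lra.
Qed.

Lemma walk_bounds w k : (k <= m)%N -> - (2 * k%:R) <= walk w k <= 2 * k%:R.
Proof.
elim: k => [|k IH] km; first by rewrite walk0 mulr0 oppr0 lexx.
rewrite (walkS w (Ordinal km)) -natr1 /=.
have := IH (ltnW km).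
have := sign_bounds (Ordinal km); have := sign_bounds (w (Ordinal km)).
by move=> /andP[? ?] /andP[? ?] /andP[? ?]; apply/andP; split; lra.
Qed.

Lemma drift_bounds w t : -1 <= drift w t <= 1.
Proof.
have /andP[? ?] := walk_bounds w (ltnW (ltn_ord t)).
have /andP[? ?] := sign_bounds t.
have t0 : 0 < (2 * t + 1)%N%:R :> R by rewrite ltr0n addn1.
rewrite /drift ler_pdivrMr // ler_pdivlMr // natrD natrM.
by apply/andP; split; lra.
Qed.

(** For [t = 0] the terms divided by [t%:R] are [0], as [0^-1 = 0]. *)
Lemma walk_step w t :
  x t * x (w t)
  - (walk w t.+1 ^+ 2 / (4 * t.+1%:R) - walk w t ^+ 2 / (4 * t%:R))
  <= (x t - drift w t) * (x (w t) - drift w t) + t%:R^-1.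
Proof.
set p := drift w t; set X := x (w t) - p.
(* In terms of [p] and [X] both quotients contain [(t+1) p^2], which cancels. Beyond [(x t - p) X]
   there remain [- X^2 / (4(t+1))] and [(p - x t)^2 / (4t)], the latter at most [1/t]. *)
have wE : walk w t = (2 * t%:R + 1) * p - x t.
  by rewrite /p /drift natrD natrM mulrC divfK ?addrK.
have wSE : walk w t.+1 = (2 * t%:R + 2) * p + X.
  by rewrite walkS wE /X; ring.
have T1 : 0 < t%:R + 1 :> R by rewrite natr1 ltr0n.
have T1n : t%:R + 1 != 0 :> R by rewrite gt_eqF.
have X0 : 0 <= X ^+ 2 / (4 * (t%:R + 1)).
  by rewrite divr_ge0 ?sqr_ge0 // mulr_ge0 // ltW.
have sq := x_sq t.
have -> : x (w t) = X + p by rewrite /X subrK.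
have VS : walk w t.+1 ^+ 2 / (4 * t.+1%:R) =
    (t%:R + 1) * p ^+ 2 + p * X + X ^+ 2 / (4 * (t%:R + 1)).
  by rewrite wSE -natr1; field.
rewrite VS.
(* At time 0 the walk vanishes, so [p = x t]: the product on the right is 0 and the left side is
   [- X^2 / 4]. *)
have [t0|t0] := eqVneq (t%:R : R) 0.
  have px : p = x t.
    have := wE; rewrite t0 mulr0 add0r mul1r.
    have -> : walk w t = 0.
      by move/eqP: t0; rewrite pnatr_eq0 => /eqP ->; rewrite walk0.
    by move/eqP; rewrite eq_sym subr_eq0 => /eqP.
  have -> : walk w t ^+ 2 / (4 * t%:R) = 0 by rewrite t0 mulr0 invr0 mulr0.
  rewrite t0 invr0 add0r in X0 *; rewrite px sq.
  rewrite -px in X0 *; nra.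
have V : walk w t ^+ 2 / (4 * t%:R) =
    (t%:R + 1) * p ^+ 2 - p * x t + (p - x t) ^+ 2 / (4 * t%:R).
  by rewrite wE; field.
have Tgt0 : 0 < t%:R :> R by rewrite lt_def t0 ler0n.
have : (p - x t) ^+ 2 / (4 * t%:R) <= t%:R^-1.
  rewrite ler_pdivrMr ?mulr_gt0 // mulrCA mulVf // mulr1.
  exact: sqr_sub_le4 (drift_bounds w t) (sign_bounds t).
rewrite V; lra.
Qed.


Lemma drift_past w w' t :
  (forall u : 'I_m, (u < t)%N -> w u = w' u) -> drift w t = drift w' t.
Proof.
move=> e; congr ((_ + _) / _); apply: eq_bigr => u ut.
by rewrite e.
Qed.

(** The score of the colouring times [m], as [m (D / 2m)^2 = D^2 / 4m]. *)
Definition sign_excess w : R :=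
  \sum_t x t * x (w t) - walk w m ^+ 2 / (4 * m%:R).

Lemma sign_excess_le w :
  sign_excess w <=
  \sum_t ((x t - drift w t) * (x (w t) - drift w t) + (t : nat)%:R^-1).
Proof.
have tele : \sum_(t < m)
    (walk w t.+1 ^+ 2 / (4 * t.+1%:R) - walk w t ^+ 2 / (4 * t%:R)) =
    walk w m ^+ 2 / (4 * m%:R).
  rewrite -(big_mkord xpredT (fun k =>
    walk w k.+1 ^+ 2 / (4 * k.+1%:R) - walk w k ^+ 2 / (4 * k%:R))).
  rewrite (telescope_sumr (fun k => walk w k ^+ 2 / (4 * k%:R))) //.
  by rewrite mulr0 invr0 mulr0 subr0.
rewrite /sign_excess -tele -sumrB; apply: ler_sum => t _.
exact: walk_step.
Qed.

Variable lam : R.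
Hypotheses (lam_ge0 : 0 <= lam) (lam_le : lam <= 1 / 8).

(** The product of these weights along [w] is its law times the exponential of [lam] times the bound
    in [sign_excess_le], so their total mass dominates the exponential moment. *)
Definition tilt w t s : R :=
  attach_prob R w t s *
  expR (lam * ((x t - drift w t) * (x s - drift w t) + (t : nat)%:R^-1)).

(** The martingale difference is at most 4 and [lam] at most 1/8, so [expR_le_quadratic] applies.
    The linear term is centred and the quadratic one has mean [lam^2 c^2 (1 - p^2)], at most
    [4 lam^2]. *)
Lemma sum_tilt_le w t :
  (forall u : 'I_m, (u < t)%N -> (w u <= u)%N) ->
  \sum_s tilt w t s <= expR (4 * lam ^+ 2 + lam * (t : nat)%:R^-1).
Proof.
move=> wle; rewrite /tilt; set p := drift w t; set c := x t - p.
have pb := drift_bounds w t; rewrite -/p in pb.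
have c4 : c ^+ 2 <= 4 by apply: sqr_sub_le4 => //; exact: sign_bounds.
(* Since [x s ^+ 2 = 1], the quadratic bound is affine in [x s], with coefficients [a] and [b]; its
   mean needs only [p]. *)
pose a := 1 - lam * c * p + lam ^+ 2 * c ^+ 2 * (1 + p ^+ 2).
pose b := lam * c - 2 * p * (lam ^+ 2 * c ^+ 2).
have le_quad s : expR (lam * (c * (x s - p))) <= a + b * x s.
  have -> : a + b * x s = 1 + lam * (c * (x s - p))
      + (lam * (c * (x s - p))) ^+ 2.
    by rewrite !exprMn (sqrrB (x s)) x_sq /a /b; ring.
  apply: expR_le_quadratic.
  have d4 : (x s - p) ^+ 2 <= 4 by apply: sqr_sub_le4 => //; exact: sign_bounds.
  by apply: le_trans (ler_wpM2l lam_ge0 (mul_le4 c4 d4)) _; have := lam_le; lra.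
apply: (@le_trans _ _
    (\sum_s attach_prob R w t s * (a + b * x s) * expR (lam * (t : nat)%:R^-1))).
  apply: ler_sum => s _; rewrite mulrDr expRD mulrA ler_wpM2r ?expR_ge0 //.
  by rewrite ler_wpM2l ?attach_prob_ge0.
rewrite -mulr_suml expRD ler_wpM2r ?expR_ge0 //.
have -> : \sum_s attach_prob R w t s * (a + b * x s) =
    a * (\sum_s attach_prob R w t s) + b * \sum_s attach_prob R w t s * x s.
  rewrite !mulr_sumr -big_split; apply: eq_bigr => s _ /=; ring.
rewrite sum_attach_prob // attach_mean // -/(walk w t) -/(drift w t) -/p.
apply: le_trans (expR_ge1Dx _).
have -> : a * 1 + b * p = 1 + lam ^+ 2 * (c ^+ 2 * (1 - p ^+ 2)).
  by rewrite /a /b; ring.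
rewrite lerD2l [leRHS]mulrC ler_wpM2l ?sqr_ge0 //.
have p2 := sqr_ge0 p.
have p1 : 0 <= 1 - p ^+ 2.
  have -> : 1 - p ^+ 2 = (1 - p) * (1 + p) by ring.
  by case/andP: pb => ? ?; rewrite mulr_ge0 //; lra.
by have := ler_wpM2r p1 c4; lra.
Qed.

Lemma sign_excess_mgf_le :
  \sum_w pa_law R w * expR (lam * sign_excess w) <=
  expR (4 * lam ^+ 2 * m%:R + lam * \sum_(t < m) t%:R^-1).
Proof.
have tilt_past w w' t s :
    (forall u : 'I_m, (u < t)%N -> w u = w' u) -> tilt w t s = tilt w' t s.
  by move=> e; rewrite /tilt (attach_prob_past _ s e) (drift_past e).
have tilt_ge0 w t s : 0 <= tilt w t s.
  by rewrite mulr_ge0 ?attach_prob_ge0 ?expR_ge0.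
pose C k : R := expR (4 * lam ^+ 2 + lam * k%:R^-1).
have -> : expR (4 * lam ^+ 2 * m%:R + lam * \sum_(t < m) t%:R^-1) =
    \prod_(t < m) C t.
  rewrite -expR_sum big_split /= sumr_const card_ord mulr_natr.
  by rewrite mulr_sumr.
apply: le_trans (sum_path_weight_le tilt_past (C := C) _ _ _) => //.
- apply: ler_sum => w _; rewrite /tilt big_split /= -expR_sum.
  rewrite ler_wpM2l ?prodr_ge0 // => [t _|]; first exact: attach_prob_ge0.
  by rewrite ler_expR -mulr_sumr ler_wpM2l ?sign_excess_le.
- by move=> k; exact: expR_ge0.
- move=> w t w0; apply: sum_tilt_le; apply: path_weight_neq0_le w0 => u.
  by apply: contra_neq; rewrite /tilt => ->; rewrite mul0r.
Qed.

End SignWalk.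

(** * The tail bound for the modularity of the merged graph *)

Lemma sum_endpoints (R : pzSemiRingType) (V : finType) (G : multigraph V)
    (f : V -> R) :
  \sum_(v <- endpoints G) f v = \sum_(e <- G) (f e.1 + f e.2).
Proof. by rewrite big_cat big_split /=; congr (_ + _); exact: big_map. Qed.

Section Tail.
Variables (R : realType) (h n : nat).
Hypotheses (h_gt0 : (0 < h)%N) (n_gt0 : (0 < n)%N).

(** Merging keeps every edge, so the score of a colouring can be computed on the mini-vertices with
    the lifted signs. *)
Definition mini_sign (s : {ffun 'I_n -> bool}) (t : 'I_(h * n)) : R :=
  (-1) ^+ s (block t).

Lemma mini_sign_sq s t : mini_sign s t ^+ 2 = 1.
Proof. exact: sqrr_sign. Qed.

Lemma sum_pa_graph (w : history (h * n)) (f : 'I_n * 'I_n -> R) :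
  \sum_(e <- pa_graph w) f e = \sum_t f (block t, block (w t)).
Proof.
rewrite big_map sum_pa_tree; apply: eq_bigl => t.
by rewrite ltn_ord.
Qed.

Lemma size_pa_graph (w : history (h * n)) : size (pa_graph w) = (h * n)%N.
Proof.
rewrite !size_map size_filter (eq_count (a2 := predT)) ?count_predT.
  exact: size_enum_ord.
by move=> t; rewrite ltn_ord.
Qed.

Lemma sign_score_pa_graph (w : history (h * n)) (s : {ffun 'I_n -> bool}) :
  sign_score (pa_graph w) (fun v => (-1) ^+ s v) =
  sign_excess (mini_sign s) w / (h * n)%N%:R.
Proof.
have m0 : (h * n)%N%:R != 0 :> R by rewrite pnatr_eq0 -lt0n muln_gt0 h_gt0.
rewrite /sign_score size_pa_graph sum_endpoints !sum_pa_graph.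
rewrite /sign_excess walkT mulrBl /mini_sign /=; congr (_ - _).
by move: (\sum_t _) ((h * n)%N%:R) m0 => y M M0; field.
Qed.

Lemma modularity_gt_sign_excess (w : history (h * n)) (c : R) :
  c < modularity R (pa_graph w) ->
  exists s, c * (h * n)%N%:R < sign_excess (mini_sign s) w.
Proof.
move=> c_lt; apply/not_existsP => no_sign.
suff : modularity R (pa_graph w) <= c by rewrite leNgt c_lt.
apply: (modularity_le_sign (Ordinal n_gt0)) => s.
rewrite sign_score_pa_graph ler_pdivrMr ?ltr0n ?muln_gt0 ?h_gt0 //.
by rewrite leNgt; apply/negP.
Qed.

Lemma pow2_le_expR : 2 ^+ n <= expR (4 / 5 * n%:R) :> R.
Proof.
rewrite expRM_natr lerXn2r ?nnegrE ?expR_ge0 //.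
(* The fourth power of [1 + 1/5] is 2.0736, just above 2. *)
have -> : 4 / 5 = 4%:R * (1 / 5) :> R by field.
rewrite expRM_natl; have e : 1 + 1 / 5 <= expR (1 / 5) :> R.
  exact: expR_ge1Dx.
have := lerXn2r 4 (_ : 1 + 1 / 5 \in Num.nneg) (_ : expR (1 / 5) \in Num.nneg) e.
rewrite !nnegrE expR_ge0 => le4; apply: le_trans (le4 _ isT); lra.
Qed.

Lemma pa_tail :
  pa_prob R (fun w : history (h * n) =>
    ~~ (modularity R (pa_graph w) <= 8 / Num.sqrt h%:R))
  <= expR (h%:R / 8 - n%:R / 80).
Proof.
set q := Num.sqrt h%:R.
have hR : 1 <= h%:R :> R by rewrite ler1n.
have q1 : 1 <= q by rewrite -sqrtr1 ler_wsqrtr.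
have qK : q ^+ 2 = h%:R by rewrite sqr_sqrtr // ler0n.
pose lam := (8 * q)^-1.
have lam0 : 0 <= lam by rewrite invr_ge0; lra.
have lam8 : lam <= 1 / 8 by rewrite mul1r lef_pV2 ?posrE; lra.
have q0 : q != 0 by rewrite gt_eqF //; lra.
have lamE : lam * (8 / q * (h * n)%N%:R) = n%:R.
  by rewrite natrM -qK /lam; field.
(* Markov's inequality and the union bound at once: on the event some colouring has
   [lam * sign_excess] above [n], so its term alone is at least the law of [w]. *)
apply: (@le_trans _ _ (\sum_(w : history (h * n)) \sum_s
    pa_law R w * expR (lam * sign_excess (mini_sign s) w) * expR (- n%:R))).
  rewrite /pa_prob big_mkcond; apply: ler_sum => w _.
  have term0 s : 0 <= pa_law R w * expR (lam * sign_excess (mini_sign s) w)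
      * expR (- n%:R) by rewrite !mulr_ge0 ?expR_ge0 ?pa_law_ge0.
  case: ifP => [|_]; last by rewrite sumr_ge0.
  rewrite -ltNge => /modularity_gt_sign_excess[s lt_s].
  rewrite (bigD1 s) //= -[leLHS]addr0 lerD ?sumr_ge0 //.
  rewrite -mulrA -expRD ler_peMr ?pa_law_ge0 // -[leLHS]expR0 ler_expR subr_ge0.
  by rewrite -[leLHS]lamE ler_wpM2l // ltW.
rewrite exchange_big /=.
have le_s s : \sum_w pa_law R w * expR (lam * sign_excess (mini_sign s) w)
    * expR (- n%:R) <= expR (n%:R / 16 + (h%:R + n%:R) / 8 - n%:R).
  rewrite -mulr_suml expRD ler_wpM2r ?expR_ge0 //.
  apply: le_trans (sign_excess_mgf_le (mini_sign_sq s) lam0 lam8) _.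
  have -> : 4 * lam ^+ 2 * (h * n)%N%:R = n%:R / 16.
    by rewrite natrM -qK /lam; field.
  rewrite ler_expR lerD2l.
  have := sum_inv_le R (h * n) h_gt0.
  have -> : (h * n)%N%:R / h%:R = n%:R :> R.
    by rewrite natrM mulrAC divff ?mul1r // gt_eqF //; lra.
  move=> sumle; apply: le_trans (ler_wpM2l lam0 sumle) _.
  by rewrite [leRHS]mulrC ler_wpM2r ?addr_ge0 //; lra.
apply: le_trans (ler_sum _ (fun s _ => le_s s)) _.
(* Counting the [2 ^ n] colourings, the coefficient of [n] in the exponent is
   [4/5 + 1/16 + 1/8 - 1 = - 1/80]. *)
rewrite sumr_const card_ffun card_bool card_ord -[leLHS]mulr_natl natrX.
apply: le_trans (ler_wpM2r (expR_ge0 _) pow2_le_expR) _.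
by rewrite -expRD ler_expR; have := ler0n R n => n0; lra.
Qed.

End Tail.

(** * Convergence of the probability to 1 *)

Lemma pa_prob_setC (R : realType) (m : nat) (E : pred (history m)) :
  pa_prob R E = 1 - pa_prob R (fun w => ~~ E w).
Proof.
by apply/eqP; rewrite eq_sym subr_eq -(sum_pa_law R m) (bigID E).
Qed.

Theorem theorem5 (R : realType) (h : nat) (h_gt0 : (0 < h)%N)
  (eps : R) (eps_gt0 : 0 < eps) :
  pa_prob R (fun w : history (h * n) =>
    modularity R (pa_graph w) <= (1 + eps) * fbound R h / Num.sqrt h%:R)
  @[n --> \oo] --> (1 : R).
Proof.
have f8 := fbound_ge8 R h_gt0.
have c_le : 8 / Num.sqrt h%:R <= (1 + eps) * fbound R h / Num.sqrt h%:R.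
  rewrite ler_wpM2r ?invr_ge0 ?sqrtr_ge0 //.
  have : 0 <= eps * fbound R h by rewrite mulr_ge0 ?ltW //; lra.
  by lra.
pose z : R := expR (- (1 / 80)).
(* The failure probability is at most [expR (h / 8) * z ^ n], a geometric sequence of ratio below
   1. *)
apply: (@squeeze_cvgr _ _ _ _
  (fun n => 1 - geometric (expR (h%:R / 8)) z n) (cst 1)); first last.
- exact: cvg_cst.
- rewrite -[X in _ --> X]subr0; apply: cvgB; first exact: cvg_cst.
  apply: cvg_geometric; rewrite ger0_norm ?expR_ge0 //.
  by rewrite /z expR_lt1; lra.
near=> n; have n_gt0 : (0 < n)%N by near: n; exact: nbhs_infty_gt.
rewrite pa_prob_setC; apply/andP; split; last first.
  by rewrite lerBlDr lerDl sumr_ge0 // => w _; exact: pa_law_ge0.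
rewrite lerD2l lerN2; apply: (@le_trans _ _ (expR (h%:R / 8 - n%:R / 80))).
  apply: le_trans (pa_tail R h_gt0 n_gt0).
  rewrite /pa_prob !(big_mkcond (fun w => ~~ _)); apply: ler_sum => w _.
  case: ifPn => [/negP nle|_]; last by case: ifP; rewrite ?pa_law_ge0.
  by rewrite ifT //; apply/negP => /le_trans /(_ c_le).
rewrite /geometric /z /= -expRM_natr -expRD ler_expR; lra.
Unshelve. all: by end_near.
Qed.
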